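(* Let $M^n(P,\lambda)$ be an $n$-dimensional small cover over a simple polytope $P$ with $k$ vertices, with its natural $\mathbb{Z}_2^n$-action. Then $\mathrm{cat}_{\mathbb{Z}_2^n}(M^n(P,\lambda)) = k$.
   Context: Small covers: an $n$-dimensional convex polytope $P$ is simple if exactly $n$ facets meet at each vertex; $\mathcal{F}(P)$ denotes its set of facets. A characteristic function is a map $\lambda\colon \mathcal{F}(P)\to\mathbb{Z}_2^n$ such that whenever distinct facets $F_{i_1},\dots,F_{i_\ell}$ satisfy $F_{i_1}\cap\cdots\cap F_{i_\ell}\neq\emptyset$, the vectors $\lambda(F_{i_1}),\dots,\lambda(F_{i_\ell})$ generate an $\ell$-dimensional direct summand of $\mathbb{Z}_2^n$. For $p\in P$ let $F(p)=F_{i_1}\cap\cdots\cap F_{i_k}$ be the unique face containing $p$ in its relative interior, and let $G_{F(p)}\subseteq\mathbb{Z}_2^n$ be the subgroup generated by $\lambda(F_{i_1}),\dots,\lambda(F_{i_k})$. The small cover is $M^n(P,\lambda)=(P\times\mathbb{Z}_2^n)/\sim$, where $(p,g)\sim(q,h)$ iff $p=q$ and $g^{-1}h\in G_{F(p)}$; it is a closed $n$-manifold. The group $\mathbb{Z}_2^n$ acts on it through the group operation on the second factor of $P\times\mathbb{Z}_2^n$. Equivariant LS-category: let $G$ be a compact topological group acting continuously on a Hausdorff space $Y$. A $G$-invariant open subset $U\subseteq Y$ is $G$-categorical if there is a $G$-equivariant homotopy $H\colon U\times I\to Y$ (i.e. $gH(y,t)=H(gy,t)$) with $H_0$ the inclusion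 and the image of $H_1$ contained in a single $G$-orbit. $\mathrm{cat}_G(Y)$ is the least positive number of $G$-categorical invariant open sets required to cover $Y$ ($\infty$ if no such cover exists). *)

(* Defs.v *)
From HB Require Import structures.
From mathcomp Require Import all_boot all_order all_fingroup all_algebra.
From mathcomp Require Import all_classical all_reals all_analysis.

Set Implicit Arguments.
Unset Strict Implicit.
Unset Printing Implicit Defensive.

Import Order.TTheory GRing.Theory Num.Theory.
Import numFieldNormedType.Exports.

Local Open Scope classical_set_scope.
Local Open Scope ring_scope.
Local Open Scope quotient_scope.

(** * Convex polytopes *)

Section Polytopes.
Context {R : realType} {m : nat}.
Implicit Types (A P F : set 'rV[R]_m).

Definition affine_set A : Prop :=
  forall (x y : 'rV[R]_m) (t : R), A x -> A y -> A ((1 - t) *: x + t *: y).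

Definition affine_hull A : set 'rV[R]_m := smallest affine_set A.

Definition convex_hull A : set 'rV[R]_m :=
  smallest (@convex_set R 'rV[R]_m) A.

(* The empty set has no dimension. *)
Definition has_dim A (d : nat) : Prop :=
  exists (x : 'rV[R]_m) (V : {vspace 'rV[R]_m}),
    affine_hull A = [set y | y - x \in V] /\ \dim V = d.

Definition relative_interior A : set 'rV[R]_m :=
  [set x | A x /\ \forall y \near x, affine_hull A y -> A y].

Definition polytope P : Prop :=
  exists2 S : set 'rV[R]_m, finite_set S & P = convex_hull S.

(* P itself (c = 0, b = 0) and the empty set (c = 0, b = 1) are faces. *)
Definition face P F : Prop :=
  exists (c : 'cV[R]_m) (b : R),
    (forall x, P x -> (x *m c) 0 0 <= b) /\
    F = P `&` [set x | (x *m c) 0 0 = b].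

Definition vertices P : set 'rV[R]_m := [set v | face P [set v]].

(* A 0-dimensional polytope has no facets. *)
Definition facets P : set (set 'rV[R]_m) :=
  [set F | face P F /\ exists d, has_dim P d.+1 /\ has_dim F d].

Definition simple_polytope (n : nat) P : Prop :=
  [/\ polytope P, has_dim P n
    & forall v, vertices P v -> ([set F | facets P F /\ F v] #= `I_n)%card].

(* The face of P that contains p in its relative interior. *)
Definition carrier_face P (p : 'rV[R]_m) : set 'rV[R]_m :=
  xget set0 [set F | face P F /\ relative_interior F p].

End Polytopes.

(** * Small covers *)

Section SmallCover.
Context {R : realType} {m n : nat} (P : set 'rV[R]_m).
Variable lambda : facets P -> 'rV['F_2]_n.

(* Over the field Z_2 every subspace is a direct summand, so only the
   dimension of the span is constrained. *)
Definition characteristic_function : Prop :=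
  forall (l : nat) (F : 'I_l -> facets P), injective F ->
    (\bigcap_(i in [set: 'I_l]) (val (F i) : set 'rV[R]_m)) !=set0 ->
    \dim <<[seq lambda (F i) | i <- enum 'I_l]>>%VS = l.

(* The subgroup G_F of (Z_2^n, +) generated by the vectors of the facets that
   contain F. *)
Definition face_group (F : set 'rV[R]_m) : {set 'rV['F_2]_n} :=
  <<finset (fun g : 'rV['F_2]_n =>
      `[< exists2 Fi : facets P, F `<=` val Fi & lambda Fi = g >])>>%g.

Definition cover_space : topologicalType :=
  ((P : topologicalType) * discrete_topology 'rV['F_2]_n)%type.

Definition cover_rel (x y : cover_space) : bool :=
  `[< x.1 = y.1 /\
      - (x.2 : 'rV['F_2]_n) + (y.2 : 'rV['F_2]_n)
        \in face_group (carrier_face P (val x.1)) >].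

Lemma cover_rel_equiv : equiv_class_of cover_rel.
Proof.
split=> [x|x y|y x z].
- by apply/asboolP; split=> //; rewrite addNr; exact: group1.
- suff sym a b : cover_rel a b -> cover_rel b a by apply/idP/idP; exact: sym.
  move=> /asboolP[ab gab]; apply/asboolP; split=> //; rewrite -ab.
  by have := groupVr gab; rewrite /invg/= opprD opprK addrC.
- move=> /asboolP[xy gxy] /asboolP[yz gyz]; apply/asboolP.
  split; first by rewrite xy.
  rewrite -xy in gyz; have := groupM gxy gyz.
  by rewrite /mulg/= addrA addrK.
Qed.

Canonical cover_equiv : equiv_rel cover_space :=
  EquivRelPack cover_rel_equiv.

Definition small_cover : topologicalType :=
  quotient_topology {eq_quot cover_equiv}.

Definition small_cover_pi (x : cover_space) : small_cover :=
  \pi_{eq_quot cover_equiv} x.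

Definition small_cover_act (g : 'rV['F_2]_n) (x : small_cover) : small_cover :=
  let y : cover_space := generic_quotient.repr (x : {eq_quot cover_equiv}) in
  small_cover_pi (y.1, g + (y.2 : 'rV['F_2]_n)).

(* The action does not depend on the chosen representative. *)
Lemma small_cover_actE (g : 'rV['F_2]_n) (p : P) (h : 'rV['F_2]_n) :
  small_cover_act g (small_cover_pi (p, h)) = small_cover_pi (p, g + h).
Proof.
rewrite /small_cover_act; apply/eqmodP => /=.
have /eqmodP/asboolP := reprK (\pi_{eq_quot cover_equiv} ((p, h) : cover_space)).
rewrite -/(small_cover_pi (p, h)).
case: (generic_quotient.repr _) => q k /= [-> kh].
by apply/asboolP; split=> //=; rewrite opprD addrACA addNr add0r.
Qed.

End SmallCover.

(** * Equivariant Lusternik-Schnirelmann category *)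

Section EquivariantCategory.
(* R only provides the unit interval I = [0, 1]. *)
Context (R : realType) {G : Type} {Y : topologicalType} (act : G -> Y -> Y).

Definition invariant_set (U : set Y) : Prop := forall g y, U y -> U (act g y).

(* Only the values of H on U x I are constrained. *)
Definition categorical (U : set Y) : Prop :=
  exists H : Y * R -> Y,
    [/\ {within U `*` `[0, 1]%classic, continuous H},
        forall g y (t : R), U y -> 0 <= t <= 1 -> act g (H (y, t)) = H (act g y, t),
        forall y, U y -> H (y, 0) = y
      & exists y0, forall y, U y -> exists g, H (y, 1) = act g y0].

Definition categorical_cover (j : nat) : Prop :=
  (0 < j)%N /\
  exists U : 'I_j -> set Y,
    (forall i, [/\ open (U i), invariant_set (U i) & categorical (U i)]) /\
    \bigcup_(i in [set: 'I_j]) U i = [set: Y].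

(* [None] stands for infinity. *)
Definition equivariant_cat : option nat :=
  match pselect (exists j, `[< categorical_cover j >]) with
  | left ex => Some (ex_minn ex)
  | right _ => None
  end.

End EquivariantCategory.

(* Main.v *)
(** A vertex v of P is a fixed point of the action: the n facets at v have
independent characteristic vectors, so G_{F(v)} is all of Z_2^n.  Near v the only
such points are those over v, hence an equivariant homotopy, which keeps fixed
points fixed, cannot join the fixed points over two vertices; a categorical set
therefore contains at most one of them and at least k sets are needed.
Conversely, the points of P all of whose facets contain v form an open star of v,
which retracts linearly onto v; the retraction only enlarges the set of facets
through a point, so it lifts to the small cover, and the stars of
the k vertices cover P.

Polytopes enter through the rows of a matrix A, P being their convex hull. A face
is the hull of the rows that are tight for a valid inequality, which turns facts
about faces into arguments about finite sets of rows. *)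

Require Import Defs.
From mathcomp Require Import all_boot all_order all_fingroup all_algebra.
From mathcomp Require Import all_classical all_reals all_analysis.
From mathcomp Require Import ring lra.

Set Implicit Arguments.
Unset Strict Implicit.
Unset Printing Implicit Defensive.

Import Order.TTheory GRing.Theory Num.Theory.
Import numFieldNormedType.Exports.

Local Open Scope classical_set_scope.
Local Open Scope ring_scope.
Local Open Scope quotient_scope.

Local Notation "x *d c" := ((x *m c) 0 0) (at level 40).

(** * Polytopes *)

Section DotProduct.
Context {R : comNzRingType} {m : nat}.
Implicit Types (x y : 'rV[R]_m) (c d : 'cV[R]_m).

Lemma dotDl x y c : (x + y) *d c = x *d c + y *d c.
Proof. by rewrite mulmxDl mxE. Qed.

Lemma dotBl x y c : (x - y) *d c = x *d c - y *d c.
Proof. by rewrite mulmxBl !mxE. Qed.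

Lemma dotZl t x c : (t *: x) *d c = t * (x *d c).
Proof. by rewrite -scalemxAl mxE. Qed.

Lemma dotDr x c d : x *d (c + d) = x *d c + x *d d.
Proof. by rewrite mulmxDr mxE. Qed.

Lemma dotNr x c : x *d (- c) = - (x *d c).
Proof. by rewrite mulmxN mxE. Qed.

Lemma dotZr t x c : x *d (t *: c) = t * (x *d c).
Proof. by rewrite -scalemxAr mxE. Qed.

Lemma dot_sum (I : Type) (r : seq I) (w : I -> R) (f : I -> 'rV[R]_m) c :
  (\sum_(i <- r) w i *: f i) *d c = \sum_(i <- r) w i * (f i *d c).
Proof.
by rewrite mulmx_suml summxE; apply: eq_bigr => i _; rewrite dotZl.
Qed.

Lemma dot_delta x (j : 'I_m) : x *d (delta_mx j 0 : 'cV_m) = x 0 j.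
Proof. by rewrite -colE mxE. Qed.

End DotProduct.

Lemma dot_col (R : comNzRingType) (m k : nat) (x : 'rV[R]_m) (M : 'M[R]_(m, k))
    (j : 'I_k) :
  x *d col j M = (x *m M) 0 j.
Proof. by rewrite colE mulmxA dot_delta. Qed.

(* Eliminating the last generator: if the functional obtained for the others is
   negative on it, project everything along it onto the kernel of the functional. *)
Lemma farkas (R : realFieldType) (m N : nat) (a : 'I_N -> 'rV[R]_m) (z : 'rV[R]_m) :
  (exists2 w : 'I_N -> R, forall i, 0 <= w i & z = \sum_i w i *: a i) \/
  (exists2 c : 'cV[R]_m, forall i, 0 <= a i *d c & z *d c < 0).
Proof.
elim: N a z => [|N IH] a z.
  have [->|z0] := eqVneq z 0.
    by left; exists (fun=> 0) => //; rewrite big_ord0.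
  right; exists (- z^T) => [[]//|]; rewrite dotNr oppr_lt0 mxE.
  have [j zj] := matrix0Pn _ z0; case: zj => k; rewrite ord1 => zk.
  rewrite (bigD1 k) //= mxE ltr_pwDl//; first by rewrite -expr2 exprn_even_gt0.
  by apply: sumr_ge0 => i _; rewrite mxE -expr2 sqr_ge0.
pose l := a ord0.
have [[w w0 zw]|[c ca cz]] := IH (fun i => a (lift ord0 i)) z.
  left; exists (fun i => if unlift ord0 i is Some j then w j else 0).
    by move=> i; case: unliftP.
  rewrite big_ord_recl unlift_none scale0r add0r zw.
  by apply: eq_bigr => i _; rewrite liftK.
have [cl|cl] := leP 0 (l *d c).
  right; exists c => // i; case: (unliftP ord0 i) => [j ->|->//]; exact: ca.
have cl0 : l *d c != 0 by rewrite lt_eqF.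
pose pr x := x - ((x *d c) / (l *d c)) *: l.
have [[w w0 zw]|[d da dz]] := IH (fun i => pr (a (lift ord0 i))) (pr z).
  (* [s] is the coefficient of [l] in [z]. It is non-negative because [c] is negative on [z] and on
     [l] and non-negative on the other generators. *)
  left; pose s := z *d c / (l *d c) - \sum_i w i * (a (lift ord0 i) *d c / (l *d c)).
  exists (fun i => if unlift ord0 i is Some j then w j else s).
    move=> i; case: unliftP => // _; rewrite subr_ge0.
    apply: (@le_trans _ _ 0); last by rewrite ler_ndivlMr // mul0r ltW.
    apply: sumr_le0 => j _; apply: mulr_ge0_le0 => //.
    by rewrite ler_ndivrMr// mul0r.
  rewrite big_ord_recl unlift_none.
  under eq_bigr => i _ do rewrite liftK.
  move/eqP: zw; rewrite subr_eq => /eqP ->.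
  have -> : \sum_i w i *: pr (a (lift ord0 i)) =
      \sum_i (w i *: a (lift ord0 i) - (w i * (a (lift ord0 i) *d c / (l *d c))) *: l).
    by apply: eq_bigr => i _; rewrite /pr scalerBr scalerA.
  by rewrite sumrB -scaler_suml /s scalerBl -/l addrAC [RHS]addrC addrA.
(* This functional is [d] composed with [pr]; in particular it vanishes on [l]. *)
right; exists (d - (l *d d / (l *d c)) *: c).
  move=> i; rewrite dotDr dotNr dotZr.
  case: (unliftP ord0 i) => [j ->|->]; last by rewrite -/l divfK// subrr.
  by have := da j; rewrite dotBl dotZl mulrAC [_ / _ * _]mulrAC [_ *d d * _]mulrC.
by move: dz; rewrite dotDr dotNr dotZr dotBl dotZl mulrAC [_ / _ * _]mulrAC
  [_ *d d * _]mulrC.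
Qed.

(** * Convex combinations *)

Section Convexity.
Context {R : realType} {m : nat}.
Implicit Types (x y p v : 'rV[R]_m).

Lemma convex_set_seg (C : set 'rV[R]_m) x y (t : R) :
  @convex_set R 'rV[R]_m C -> C x -> C y -> 0 <= t <= 1 ->
  C ((1 - t) *: x + t *: y).
Proof.
move=> convC Cx Cy /andP[t0 t1].
have := convC y x (Itv01 t0 t1) (mem_set Cy) (mem_set Cx).
by rewrite inE /conv/= addrC.
Qed.

(** The point [z] takes up the missing weight, so the induction need not renormalize the family:
    each [f i] is absorbed by moving [z] towards it. *)
Lemma convex_comb (C : set 'rV[R]_m) (I : Type) (r : seq I) (w : I -> R) f z :
  @convex_set R 'rV[R]_m C -> C z -> (forall i, 0 <= w i) ->
  (forall i, C (f i)) -> \sum_(i <- r) w i <= 1 ->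
  C ((1 - \sum_(i <- r) w i) *: z + \sum_(i <- r) w i *: f i).
Proof.
move=> convC Cz w0 Cf; elim: r z Cz => [|i r IH] z Cz.
  by rewrite !big_nil subr0 scale1r addr0.
rewrite !big_cons; set s := \sum_(j <- r) w j => sw.
have s1 : s <= 1 by apply: le_trans sw; rewrite lerDr.
have [s1'|s1'] := eqVneq s 1.
  have wi : w i = 0 by apply/eqP; rewrite eq_le w0 andbT; move: sw; rewrite s1'; lra.
  by rewrite wi scale0r !add0r; exact: IH.
have s_gt : 0 < 1 - s by rewrite subr_gt0 lt_neqAle s1'.
(* The weight [1 - s] is shared by [z] and [f i]; [t] is the share of [f i]. *)
pose t := w i / (1 - s).
have t01 : 0 <= t <= 1.
  by rewrite /t divr_ge0 ?(ltW s_gt)//= ler_pdivrMr// mul1r; lra.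
have := IH _ (convex_set_seg convC Cz (Cf i) t01) s1.
rewrite -/s scalerDr !scalerA addrA.
by rewrite mulrBr mulr1 {1 2}/t mulrC divfK ?gt_eqF// opprD addrA (addrAC 1).
Qed.

End Convexity.

(** * Hulls of rows: faces, affine hulls and vertices *)

Section Hull.
Context {R : realType} {m N : nat} (A : 'M[R]_(N, m)).
Implicit Types (x y p v : 'rV[R]_m) (c d : 'cV[R]_m) (b t : R).
Implicit Types (J : {set 'I_N}) (w : 'I_N -> R).

(** Weights live on all row indices and vanish off [J], so that sums for different [J] range over
    the same index type. *)
Definition weight J w : Prop :=
  [/\ forall i, 0 <= w i, \sum_i w i = 1 & forall i, i \notin J -> w i = 0].

Definition hull J : set 'rV[R]_m :=
  [set x | exists2 w, weight J w & x = \sum_i w i *: row i A].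

Definition valid c b : Prop := forall i, row i A *d c <= b.

Definition tight c b : {set 'I_N} := finset (fun i => row i A *d c == b).

Lemma hull_row J i : i \in J -> hull J (row i A).
Proof.
move=> iJ; exists (fun j => (j == i)%:R); last first.
  rewrite (bigD1 i) //= eqxx scale1r big1 ?addr0// => j /negPf ->.
  by rewrite scale0r.
split=> [j||j jJ]; first exact: ler0n.
  by rewrite (bigD1 i) //= eqxx big1 ?addr0// => j /negPf ->.
by case: eqP => // ji; rewrite ji iJ in jJ.
Qed.

Lemma weight_neq0 J w : weight J w -> exists i, i \in J.
Proof.
case=> _ w1 wJ; apply/set0Pn/eqP => J0.
by move: w1; rewrite big1 => [|i _]; [lra | rewrite wJ// J0 inE].
Qed.

Lemma convex_hull_rows J : @convex_set R 'rV[R]_m (hull J).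
Proof.
move=> x y t /set_mem[w [w0 w1 wJ] ->] /set_mem[u [u0 u1 uJ] ->]; apply: mem_set.
exists (fun i => t%:num * w i + (1 - t%:num) * u i).
  split=> [i||i iJ].
  - by rewrite addr_ge0// mulr_ge0// subr_ge0.
  - by rewrite big_split/= -!mulr_sumr w1 u1; ring.
  - by rewrite wJ// uJ// !mulr0 addr0.
rewrite /conv/= !scaler_sumr -big_split/=; apply: eq_bigr => i _.
by rewrite !scalerA -scalerDl.
Qed.

Lemma hull_min J (C : set 'rV[R]_m) :
  @convex_set R 'rV[R]_m C -> (forall i, i \in J -> C (row i A)) -> hull J `<=` C.
Proof.
move=> convC CA x [w wJ ->]; have [i0 i0J] := weight_neq0 wJ.
case: wJ => w0 w1 wJ.
(* Rows outside [J] may lie outside [C]; since their weight is zero, [row i0 A] can stand in for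
   them. *)
have := @convex_comb R m C _ (index_enum 'I_N) w
  (fun i => if i \in J then row i A else row i0 A) _ convC (CA _ i0J) w0.
rewrite w1 subrr scale0r add0r lexx => /(_ _ erefl).
have -> : \sum_i w i *: (if i \in J then row i A else row i0 A) =
    \sum_i w i *: row i A.
  by apply: eq_bigr => i _; case: ifPn => // /wJ ->; rewrite !scale0r.
by apply=> i; case: ifPn => iJ; exact: CA.
Qed.

Lemma hull_le c b x : valid c b -> hull [set: _]%SET x -> x *d c <= b.
Proof.
move=> cb [w [w0 w1 _] ->]; rewrite dot_sum -[b]mul1r -w1 mulr_suml.
by apply: ler_sum => i _; rewrite ler_wpM2l.
Qed.

(** The slacks [b - row i A *d c] are non-negative. If their weighted sum is zero, every row of
    non-zero weight is tight. *)
Lemma hull_tight c b : valid c b ->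
  hull [set: _]%SET `&` [set x | x *d c = b] = hull (tight c b).
Proof.
move=> cb; apply/seteqP; split=> [x [[w [w0 w1 _] ->]] /=|x [w [w0 w1 wJ] ->]].
  rewrite dot_sum => wb; exists w => //; split=> // i iJ.
  have /psumr_eq0P : \sum_i w i * (b - row i A *d c) = 0.
    under eq_bigr => j _ do rewrite mulrBr.
    by rewrite sumrB -mulr_suml w1 wb mul1r subrr.
  move=> /(_ _ i isT) /eqP; rewrite mulf_eq0 subr_eq0 => /(_ _)/orP[|/eqP|bi].
  - by move=> j _; rewrite mulr_ge0// subr_ge0.
  - by [].
  - by move: iJ; rewrite inE eq_sym bi.
split; first by exists w => //; split=> // i; rewrite inE.
rewrite /= dot_sum -[RHS]mul1r -w1 mulr_suml; apply: eq_bigr => i _.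
have [|/wJ ->] := boolP (i \in tight c b); last by rewrite !mul0r.
by rewrite inE => /eqP ->.
Qed.

Lemma face_hullP F : face (hull [set: _]%SET) F <->
  exists c b, valid c b /\ F = hull (tight c b).
Proof.
split=> [[c [b [cb ->]]]|[c [b [cb ->]]]]; exists c, b.
  have v : valid c b by move=> i; apply: cb; apply: hull_row; rewrite inE.
  by rewrite hull_tight.
by rewrite hull_tight//; split=> // x; exact: hull_le.
Qed.

Lemma affine_set_scale (C : set 'rV[R]_m) v y t :
  affine_set C -> C v -> C (v + y) -> C (v + t *: y).
Proof.
move=> aC Cv Cy; have := aC _ _ t Cv Cy.
by rewrite scalerBl scalerDr scale1r addrA subrK.
Qed.

Lemma affine_set_add (C : set 'rV[R]_m) v x y :
  affine_set C -> C v -> C (v + x) -> C (v + y) -> C (v + (x + y)).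
Proof.
move=> aC Cv Cx Cy.
(* The point [v + (x + y)] is the midpoint of [v + 2x] and [v + 2y]. *)
have := aC _ _ 2^-1 (affine_set_scale 2 aC Cv Cx) (affine_set_scale 2 aC Cv Cy).
rewrite !scalerDr !scalerA addrACA -scalerDl subrK scale1r mulVf ?pnatr_eq0//.
by rewrite mulrBl mul1r mulVf ?pnatr_eq0// (_ : 2 - 1 = 1) ?scale1r//; ring.
Qed.

(** For [v] in [hull J] this is the direction space of the affine hull, and its dimension is that of
    the hull. *)
Definition dir J v := <<[seq row i A - v | i <- enum J]>>%VS.

Lemma mem_dir J v i : i \in J -> row i A - v \in dir J v.
Proof. by move=> iJ; apply/memv_span/map_f; rewrite mem_enum. Qed.

Lemma affine_span (C : set 'rV[R]_m) v (s : seq 'rV[R]_m) y :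
  affine_set C -> C v -> (forall u, u \in s -> C (v + u)) -> y \in << s >>%VS ->
  C (v + y).
Proof.
move=> aC Cv; elim: s y => [|u s IH] y Cs.
  by rewrite span_nil memv0 => /eqP ->; rewrite addr0.
rewrite span_cons => /memv_addP[a /vlineP[t ->]] [z zs ->].
apply: affine_set_add => //.
  by apply: affine_set_scale => //; apply: Cs; rewrite mem_head.
by apply: IH => // u' u's; apply: Cs; rewrite inE u's orbT.
Qed.

Lemma affine_hull_hull J v : hull J v ->
  affine_hull (hull J) = [set y | y - v \in dir J v].
Proof.
move=> Jv; apply/seteqP; split.
  apply: smallest_sub => [x y t /= xv yv|_ [w [w0 w1 wJ] ->] /=].
    have -> : (1 - t) *: x + t *: y - v = (1 - t) *: (x - v) + t *: (y - v).
      rewrite !scalerBr addrACA -opprD -scalerDl.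
      by rewrite (_ : 1 - t + t = 1) ?scale1r//; ring.
    by rewrite memvD ?memvZ.
  have -> : \sum_i w i *: row i A - v = \sum_i w i *: (row i A - v).
    under [RHS]eq_bigr => i _ do rewrite scalerBr.
    by rewrite sumrB -scaler_suml w1 scale1r.
  apply: memv_suml => i _; have [iJ|/wJ ->] := boolP (i \in J).
    by rewrite memvZ// mem_dir.
  by rewrite scale0r mem0v.
move=> y /= yv C [aC JC]; rewrite -[y](subrK v) addrC.
apply: affine_span yv => //; first exact: JC.
move=> u /mapP[i]; rewrite mem_enum => iJ ->; rewrite addrC subrK.
by apply: JC; exact: hull_row.
Qed.

Lemma dim_dir J v (d : nat) : hull J v -> has_dim (hull J) d -> \dim (dir J v) = d.
Proof.
move=> Jv [x [V [hV <-]]]; congr (\dim _); move: hV; rewrite (affine_hull_hull Jv).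
move=> /seteqP[VW WV].
have vx : v - x \in V by apply: VW; rewrite /= subrr mem0v.
apply/vspaceP => u; apply/idP/idP => hu.
  have := VW (u + v); rewrite /= addrK => /(_ hu) ux.
  by rewrite -(addrK (v - x) u) memvB// addrA.
by have := WV (u + v); rewrite /= addrK; apply; rewrite -addrA memvD.
Qed.

Lemma has_dim_hull J v : hull J v -> has_dim (hull J) (\dim (dir J v)).
Proof. by move=> Jv; exists v, (dir J v); split=> //; exact: affine_hull_hull. Qed.

(** For large [t] the functional [c] dominates: rows off its face stay slack, and [d] alone decides
    among the rows of the face. Thus a face of a face is a face. *)
Lemma tight_perturb c b d b' : valid c b ->
  (forall i, i \in tight c b -> row i A *d d <= b') ->
  exists t, valid (t *: c + d) (t * b + b') /\
    tight (t *: c + d) (t * b + b') =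
      finset (fun i => (i \in tight c b) && (row i A *d d == b')).
Proof.
move=> cb db.
(* Any [t] above [f i] keeps a slack row [i] slack, the [+ 1] making this strict. On tight rows the
   division by zero gives 0, so the sum of all [f i] can serve as [t]. *)
pose f i := (`|row i A *d d - b'| + 1) / (b - row i A *d c).
have f0 i : 0 <= f i by apply: divr_ge0; [rewrite addr_ge0 | rewrite subr_ge0].
pose t := \sum_i f i; exists t.
have lt_i i : i \notin tight c b -> row i A *d (t *: c + d) < t * b + b'.
  rewrite inE => ib; have bi : 0 < b - row i A *d c.
    by rewrite subr_gt0 lt_neqAle ib cb.
  have : f i <= t by rewrite /t (bigD1 i)//= lerDl sumr_ge0.
  rewrite ler_pdivrMr// dotDr dotZr => fi.
  have := ler_norm (row i A *d d - b'); move: fi; rewrite mulrBr.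
  lra.
have eq_i i : i \in tight c b -> row i A *d (t *: c + d) = t * b + row i A *d d.
  by rewrite inE => /eqP bi; rewrite dotDr dotZr bi.
split=> [i|].
  have [it|/lt_i/ltW//] := boolP (i \in tight c b).
  by rewrite eq_i// lerD2l db.
apply/setP => i; rewrite [LHS]inE [RHS]inE.
have [it|/lt_i/lt_eqF//] := boolP (i \in tight c b).
by rewrite eq_i// (inj_eq (addrI _)).
Qed.

(** Descent on the number of tight rows: if two of them differ in a coordinate, maximizing that
    coordinate cuts out a smaller face. As rows may repeat, the descent ends when all tight rows are
    equal, not when one index is left. *)
Lemma vertex_in_face c b : valid c b -> hull (tight c b) !=set0 ->
  exists2 v, vertices (hull [set: _]%SET) v & hull (tight c b) v.
Proof.
move=> cb [x [w /weight_neq0[i it] _]] {x w}.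
have [s] := ubnP #|tight c b|; elim: s => // s IH in c b i cb it *.
move=> ts.
have [i' /andP[i't ii']|same] := pickP (fun j => (j \in tight c b) && (row j A != row i A)).
  have [j ijj'] : exists j, row i' A 0 j != row i A 0 j.
    apply/existsP; apply: contraR ii'; rewrite negb_exists => /forallP e.
    by apply/eqP/rowP => j; apply/eqP; have := e j; rewrite negbK.
  pose d : 'cV[R]_m := delta_mx j 0.
  have [k kt kmax] := @arg_maxP _ _ _ i (mem (tight c b)) (fun k => row k A *d d) it.
  have {}kt : k \in tight c b := kt.
  have [t [vt tt]] := tight_perturb cb kmax.
  have sub : tight (t *: c + d) (t * b + row k A *d d) \proper tight c b.
    rewrite tt; apply/properP; split.
      by apply/fintype.subsetP => l; rewrite inE => /andP[].
    have [ik|ik] := eqVneq (row i A *d d) (row k A *d d).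
      exists i' => //; rewrite inE i't/= -ik.
      by rewrite !dot_delta.
    by exists i => //; rewrite inE it.
  have kt' : k \in tight (t *: c + d) (t * b + row k A *d d).
    by rewrite tt inE kt eqxx.
  have [v vv vF] := IH _ _ k vt kt' (leq_trans (proper_card sub) ts).
  exists v => //; apply: hull_min vF => [|l lt]; first exact: convex_hull_rows.
  by apply: hull_row; have /properP[/fintype.subsetP] := sub => + _; exact.
have hi : hull (tight c b) = [set row i A].
  apply/seteqP; split=> [_ [w [w0 w1 wt] ->]|_ ->]; last exact: hull_row.
  rewrite /= -[RHS]scale1r -w1 scaler_suml; apply: eq_bigr => j _.
  have [jt|/wt ->] := boolP (j \in tight c b); last by rewrite !scale0r.
  by have := same j; rewrite jt/= => /negbFE/eqP ->.
exists (row i A); last by rewrite hi.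
by apply/face_hullP; exists c, b.
Qed.

End Hull.

(** Subtracting the projection onto [U] kills [U] but not [x]; a non-zero coordinate of the result,
    with its sign corrected, is the functional. *)
Lemma vanishing_functional (R : realFieldType) (m : nat) (U : {vspace 'rV[R]_m}) x :
  x \notin U -> exists2 d : 'cV[R]_m, forall u, u \in U -> u *d d = 0 & 0 < x *d d.
Proof.
move=> xU; pose f : 'End('rV[R]_m) := (\1 - projv U)%VF.
have fU u : u \in U -> f u = 0.
  by move=> uU; rewrite add_lfunE opp_lfunE id_lfunE projv_id// subrr.
have fx : f x != 0.
  apply: contra xU; rewrite add_lfunE opp_lfunE id_lfunE subr_eq0 => /eqP ->.
  exact: memv_proj.
have [i [j xj]] := matrix0Pn _ fx; rewrite (ord1 i) in xj => {i}.
pose c := col j (lin1_mx f).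
have cE u : u *d c = f u 0 j by rewrite dot_col mul_rV_lin1.
exists (Num.sg (x *d c) *: c) => [u /fU fu0|].
  have cu0 : u *d c = 0 by rewrite cE fu0 mxE.
  by rewrite dotZr cu0 mulr0.
by rewrite dotZr -normrEsg normr_gt0 cE.
Qed.

Lemma dot_continuous (R : realType) (m : nat) (c : 'cV[R]_m) :
  continuous (fun x : 'rV[R]_m => x *d c).
Proof.
have -> : (fun y : 'rV[R]_m => y *d c) = (fun y => \sum_j y 0 j * c j 0).
  by apply/funext => y; rewrite mxE.
apply: (@continuous_big _ _ +%R 0 xpredT _ _ _ (fun j (y : 'rV[R]_m) => y 0 j * c j 0)).
  exact: add_continuous.
move=> j _ y.
exact: (cvgM (@coord_continuous R 1 m 0 j y) (@cvg_cst _ (c j 0) _ (nbhs y) _)).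
Qed.

(** * Growing a face to a facet, and the minimal face through a point *)

Section Faces.
Context {R : realType} {m N : nat} (A : 'M[R]_(N, m)).
Implicit Types (x y p v : 'rV[R]_m) (c d : 'cV[R]_m) (b t : R).
Implicit Types (J : {set 'I_N}) (w : 'I_N -> R).

Local Notation full := [set: 'I_N]%SET.

Lemma hull_mono J J' : J \subset J' -> hull A J `<=` hull A J'.
Proof.
move=> /fintype.subsetP JJ'; apply: hull_min => [|i iJ]; first exact: convex_hull_rows.
by apply: hull_row; exact: JJ'.
Qed.

Lemma dir_mono J J' v : J \subset J' -> (dir A J v <= dir A J' v)%VS.
Proof.
move=> /fintype.subsetP JJ'; apply: sub_span => u /mapP[i]; rewrite mem_enum => iJ ->.
by apply: map_f; rewrite mem_enum JJ'.
Qed.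

Lemma hull_dir J v x : hull A J v -> hull A J x -> x - v \in dir A J v.
Proof.
move=> Jv Jx; have : affine_hull (hull A J) x by move=> C [_]; apply.
by rewrite (affine_hull_hull Jv).
Qed.

Lemma dir_tight c b v u : valid A c b -> hull A (tight A c b) v ->
  u \in dir A (tight A c b) v -> u *d c = 0.
Proof.
move=> cb tv; rewrite -(hull_tight cb) in tv; case: tv => _ /= vb.
have aff : affine_set [set y : 'rV[R]_m | y *d c = 0].
  by move=> x y t /= x0 y0; rewrite dotDl !dotZl x0 y0 !mulr0 addr0.
move=> uv; have := @affine_span R m _ 0 _ u aff _ _ uv; rewrite /= add0r; apply.
  by rewrite /= mul0mx mxE.
move=> {uv}u /mapP[i]; rewrite mem_enum inE => /eqP ib ->.
by rewrite /= add0r dotBl ib vb subrr.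
Qed.

(* Tilt the supporting hyperplane about the affine span of the face and p until
   it meets a new row: the face grows and still misses p. *)
Lemma tight_grow c b v p (i : 'I_N) : valid A c b -> hull A (tight A c b) v ->
  p *d c < b -> row i A - v \notin (dir A (tight A c b) v + <[p - v]>)%VS ->
  exists c' b', [/\ valid A c' b', hull A (tight A c' b') v, p *d c' < b' &
    (\dim (dir A (tight A c b) v) < \dim (dir A (tight A c' b') v))%N].
Proof.
move=> cb tv pb /vanishing_functional[d dU di].
have dp : p *d d = v *d d.
  apply/eqP; rewrite -subr_eq0 -dotBl; apply/eqP/dU.
  by rewrite (subvP (addvSr _ _))// memv_line.
have dt j : j \in tight A c b -> row j A *d d = v *d d.
  move=> jt; apply/eqP; rewrite -subr_eq0 -dotBl; apply/eqP/dU.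
  by rewrite (subvP (addvSl _ _))// mem_dir.
(* [e j] is the tilt at which row [j] becomes tight. Only rows on which [d] exceeds its value at [v]
   can be met, and the least tilt keeps the inequality valid. *)
pose e j := (b - row j A *d c) / (row j A *d d - v *d d).
have di' : v *d d < row i A *d d by rewrite -subr_gt0 -dotBl.
have [k kd kmin] := @arg_minP _ _ _ i [pred j | v *d d < row j A *d d] e di'.
have {}kd : v *d d < row k A *d d := kd.
have ek0 : 0 <= e k by rewrite divr_ge0// ?subr_ge0 ?cb// ltW.
exists (c + e k *: d), (b + e k * (v *d d)).
have cb' : valid A (c + e k *: d) (b + e k * (v *d d)).
  move=> j; rewrite dotDr dotZr.
  have [dj|dj] := leP (row j A *d d) (v *d d).
    by rewrite lerD ?cb// ler_wpM2l.
  have := kmin j dj; rewrite {2}/e ler_pdivlMr ?subr_gt0// mulrBr; lra.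
have sub : tight A c b \subset tight A (c + e k *: d) (b + e k * (v *d d)).
  apply/fintype.subsetP => j jt; have := jt; rewrite !inE => /eqP jb.
  by rewrite dotDr dotZr jb dt.
have tv' := hull_mono sub tv.
split=> //; first by rewrite dotDr dotZr dp ltrD2r.
have kt : k \in tight A (c + e k *: d) (b + e k * (v *d d)).
  rewrite inE dotDr dotZr; apply/eqP.
  have : e k * (row k A *d d - v *d d) = b - row k A *d c.
    by rewrite /e divfK// gt_eqF// subr_gt0.
  rewrite mulrBr; lra.
(* The dimension rises because [d] vanishes on the old directions but not on [row k A - v]. *)
rewrite (ltn_leqif (dimv_leqif_sup (dir_mono v sub))); apply/negP => /subvP/(_ _ (mem_dir A v kt)).
move=> kv; have := dU _ (subvP (addvSl _ _) _ kv); rewrite dotBl; lra.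
Qed.

(** Induction on the codimension of a face through [v] that misses [p]. Either its directions and
    [p - v] span those of the polytope, and it is a facet, or some row lies outside this span and
    [tight_grow] applies. *)
Lemma exists_facet n c b v p : has_dim (hull A full) n -> valid A c b ->
  hull A (tight A c b) v -> hull A full p -> p *d c < b ->
  exists F, [/\ facets (hull A full) F, F v & ~ F p].
Proof.
move=> dimP; have [s] := ubnP (n - \dim (dir A (tight A c b) v)).
elim: s => // s IH in c b *; rewrite ltnS => ns cb tv Pp pb.
have Pv : hull A full v by apply: hull_mono tv; exact: finset.subsetT.
have vb : v *d c = b by move: tv; rewrite -(hull_tight cb) => -[].
have dimn := dim_dir Pv dimP.
have sub_full J : (dir A J v <= dir A full v)%VS by apply: dir_mono; exact: finset.subsetT.
have pv : p - v \notin dir A (tight A c b) v.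
  by apply/negP => /(dir_tight cb tv); rewrite dotBl; lra.
have pvP : p - v \in dir A full v by exact: hull_dir.
have dimS : \dim (dir A (tight A c b) v + <[p - v]>)%VS =
    (\dim (dir A (tight A c b) v)).+1.
  rewrite dimv_disjoint_sum ?dim_vline.
    by case: eqVneq pv => [->|_ _]; rewrite ?mem0v// addn1.
  apply/eqP; rewrite -subv0; apply/subvP => u.
  rewrite memv_cap memv0 => /andP[uV /vlineP[t ut]]; rewrite ut.
  have [->|t0] := eqVneq t 0; first by rewrite scale0r.
  by case/negP: pv; move: uV; rewrite ut => /(memvZ t^-1); rewrite scalerA mulVf// scale1r.
have leP : (dir A (tight A c b) v + <[p - v]> <= dir A full v)%VS.
  by rewrite subv_add sub_full -memvE.
have [PU|] := boolP (dir A full v <= dir A (tight A c b) v + <[p - v]>)%VS.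
  have nE : n = (\dim (dir A (tight A c b) v)).+1.
    by rewrite -dimn -dimS; apply/eqP; rewrite eqn_leq !dimvS.
  exists (hull A (tight A c b)); split=> //.
    split; first by apply/face_hullP; exists c, b.
    exists (\dim (dir A (tight A c b) v)); rewrite -nE; split=> //.
    exact: has_dim_hull.
  by rewrite -(hull_tight cb) => -[_ /= pb']; move: pb; rewrite pb' ltxx.
move=> PU; have [i iU] : exists i, row i A - v \notin (dir A (tight A c b) v + <[p - v]>)%VS.
  apply/existsP; apply: contraR PU; rewrite negb_exists => /forallP e.
  by apply/span_subvP => _ /mapP[i _ ->]; have := e i; rewrite negbK.
have [c' [b' [cb' tv' pb' lt_dim]]] := tight_grow cb tv pb iU.
apply: IH cb' tv' Pp pb'; apply: leq_trans ns; rewrite ltn_sub2l//.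
by rewrite -dimn -dimS dimvS.
Qed.

(** Adding valid functionals intersects the faces through [p], by [tight_perturb]. Starting from the
    whole polytope, any face that is not yet minimal is replaced by such an intersection, which has
    fewer tight rows. *)
Lemma minimal_face p : hull A full p -> exists c b,
  [/\ valid A c b, hull A (tight A c b) p & forall c' b', valid A c' b' ->
    hull A (tight A c' b') p -> tight A c b \subset tight A c' b'].
Proof.
move=> Pp; suff main s c b : (#|tight A c b| < s)%N -> valid A c b ->
    hull A (tight A c b) p -> exists c b,
    [/\ valid A c b, hull A (tight A c b) p & forall c' b', valid A c' b' ->
    hull A (tight A c' b') p -> tight A c b \subset tight A c' b'].
  have v0 : valid A 0 0 by move=> i; rewrite mulmx0 mxE.
  apply: (main _ 0 0 (ltnSn _) v0).
  by rewrite -(hull_tight v0); split=> //=; rewrite mulmx0 mxE.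
elim: s => // s IH in c b *; rewrite ltnS => ts cb tp.
have [min|] := pselect (forall c' b', valid A c' b' ->
    hull A (tight A c' b') p -> tight A c b \subset tight A c' b').
  by exists c, b.
move=> /existsNP[c' /existsNP[b' /not_implyP[cb' /not_implyP[tp' sub]]]].
have [t [vt tt]] := tight_perturb cb (fun i _ => cb' i).
have pE : hull A (tight A (t *: c + c') (t * b + b')) p.
  move: tp tp'; rewrite -!hull_tight// => -[_ /= pb] [_ /= pb'].
  by split=> //=; rewrite dotDr dotZr pb pb'.
apply: IH vt pE; apply: leq_trans ts; apply: proper_card.
have ttE : tight A (t *: c + c') (t * b + b') = tight A c b :&: tight A c' b'.
  by rewrite tt; apply/setP => i; rewrite !inE.
rewrite ttE properE finset.subsetIl/=; apply/negP => /fintype.subsetP H; apply: sub.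
by apply/fintype.subsetP => i /H; rewrite inE => /andP[].
Qed.

(* Farkas: otherwise a hyperplane through p would separate row i from the face. *)
Lemma minimal_face_extend c b p i : valid A c b -> hull A (tight A c b) p ->
  (forall c' b', valid A c' b' ->
    hull A (tight A c' b') p -> tight A c b \subset tight A c' b') ->
  i \in tight A c b ->
  exists t, 0 < t <= 1 /\ hull A (tight A c b) (p - t *: (row i A - p)).
Proof.
move=> cb tp min it.
have [Pp pb] : hull A full p /\ p *d c = b by move: tp; rewrite -(hull_tight cb).
have [[w w0 pw]|[d d0 dp]] := farkas (fun j => row j A - p) (p - row i A).
  have W0 : 0 <= \sum_j w j by exact: sumr_ge0.
  have W1 : 0 < 1 + \sum_j w j by rewrite ltr_pwDl.
  (* The [1 +] keeps the denominator positive and bounds both [t] and the sum of the weights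
     [t * w j] by 1. *)
  pose t := (1 + \sum_j w j)^-1; have t0 : 0 < t by rewrite invr_gt0.
  exists t; split.
    by rewrite t0/= /t invf_le1// lerDl.
  rewrite -(hull_tight cb); split; last first.
    rewrite /= dotBl dotZl dotBl pb; move: it; rewrite inE => /eqP ->.
    by rewrite subrr mulr0 subr0.
  have tw : \sum_j t * w j <= 1.
    by rewrite -mulr_sumr mulrC ler_pdivrMr// mul1r lerDr.
  have := convex_comb (@convex_hull_rows R m N A full) Pp
    (fun j => mulr_ge0 (ltW t0) (w0 j)) (fun j => hull_row A (finset.in_setT j)) tw.
  congr hull; rewrite -[row i A - p]opprB pw scalerN opprK scaler_sumr.
  under [in RHS]eq_bigr => j _ do rewrite scalerA scalerBr.
  by rewrite sumrB -scaler_suml scalerBl scale1r addrAC addrA.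
exfalso; have vd : valid A (- d) (- (p *d d)).
  by move=> j; rewrite dotNr lerN2 -subr_ge0 -dotBl.
have pd : hull A (tight A (- d) (- (p *d d))) p.
  by rewrite -(hull_tight vd); split=> //=; rewrite dotNr.
have /fintype.subsetP/(_ i it) := min _ _ vd pd.
by rewrite inE dotNr eqr_opp => /eqP id_; move: dp; rewrite dotBl id_ subrr ltxx.
Qed.

(** The pseudoinverse selects coefficients that are linear, hence continuous, in [u]: near [p] the
    coefficients of [y - p] are small. *)
Lemma dir_coordinates J p : exists g : 'I_N -> 'cV[R]_m, forall u,
  u \in dir A J p ->
  u = \sum_i (u *d g i) *: (if i \in J then row i A - p else 0).
Proof.
pose B : 'M[R]_(N, m) := \matrix_i (if i \in J then row i A - p else 0).
exists (fun i => col i (pinvmx B)) => u uJ.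
have uB : (u <= B)%MS.
  have aff : affine_set [set y : 'rV[R]_m | (y <= B)%MS].
    by move=> x y t /= xB yB; rewrite addmx_sub ?scalemx_sub.
  have := @affine_span R m _ 0 _ u aff _ _ uJ; rewrite /= add0r; apply.
    exact: sub0mx.
  move=> z /mapP[i]; rewrite mem_enum => iJ ->; rewrite add0r.
  by have := row_sub i B; rewrite rowK iJ.
rewrite -{1}(mulmxKpV uB) mulmx_sum_row; apply: eq_bigr => i _.
by rewrite rowK dot_col.
Qed.

Lemma minimal_face_interior c b p : valid A c b -> hull A (tight A c b) p ->
  (forall c' b', valid A c' b' ->
    hull A (tight A c' b') p -> tight A c b \subset tight A c' b') ->
  relative_interior (hull A (tight A c b)) p.
Proof.
move=> cb tp min; split=> //; set J := tight A c b.
have /choice[e eP] : forall i, exists t, i \in J ->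
    0 < t <= 1 /\ hull A J (p - t *: (row i A - p)).
  move=> i; have [iJ|_] := boolP (i \in J); last by exists 0.
  by have [t tP] := minimal_face_extend cb tp min iJ; exists t.
have [g gP] := dir_coordinates J p.
have N0 : 0 < N%:R :> R.
  have [w wJ _] := tp; have [[i iN] _] := weight_neq0 wJ.
  by rewrite ltr0n; exact: leq_ltn_trans iN.
(* With [e i] at most 1, this bound makes each of the [N] weights [w i] below at most [1 / N], so
   that they sum to at most 1. *)
have : \forall y \near p, forall i, i \in J -> `|(y - p) *d g i| < e i / N%:R.
  apply: (@filter_forall _ _ _ (nbhs p) _) => i; have [iJ|iJ] := boolP (i \in J); last first.
    by apply: filterE => y iJ'; case/negP: iJ.
  have [/andP[e0 _] _] := eP i iJ.
  have eN : 0 < e i / N%:R by rewrite divr_gt0.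
  have : \forall y \near p, `|p *d g i - y *d g i| < e i / N%:R.
    exact: (cvgr_dist_lt (fun y => y *d g i) _ (@dot_continuous R m (g i) p) _ eN).
  by apply: filterS => y ye _; rewrite distrC dotBl in ye *.
apply: filterS => y ye; rewrite (affine_hull_hull tp) /= => yp.
pose a i := (y - p) *d g i.
(* A positive coefficient moves [p] towards the row; a negative one moves it towards the point of
   the face on the opposite side, given by [minimal_face_extend]. *)
pose f i := if i \in J then if 0 <= a i then row i A else p - e i *: (row i A - p) else p.
pose w i := if i \in J then if 0 <= a i then a i else - a i / e i else 0.
have wle i : 0 <= w i <= N%:R^-1.
  rewrite /w; case: ifP => iJ; last by rewrite lexx invr_ge0 ltW.
  have [/andP[e0 e1] _] := eP i iJ; have := ye i iJ; rewrite -/(a i).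
  case: ifPn => a0.
    rewrite ger0_norm// a0/= => /ltW/le_trans; apply.
    by rewrite -[leRHS]mul1r ler_wpM2r// invr_ge0 ltW.
  rewrite -ltNge in a0; rewrite ltr0_norm// => ae.
  rewrite divr_ge0 ?(ltW e0) ?oppr_ge0 ?(ltW a0)//=.
  by rewrite ler_pdivrMr// mulrC ltW.
have w0 i : 0 <= w i by case/andP: (wle i).
have w1 : \sum_i w i <= 1.
  have : \sum_i w i <= \sum_(i < N) N%:R^-1 by apply: ler_sum => i _; case/andP: (wle i).
  by rewrite sumr_const card_ord -[_ *+ N]mulr_natr mulVf// gt_eqF.
have fJ i : hull A J (f i).
  rewrite /f; case: ifPn => // iJ; have [_ ?] := eP i iJ.
  by case: ifP => // _; exact: hull_row.
have := convex_comb (@convex_hull_rows R m N A J) tp w0 fJ w1.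
have -> : y = p + \sum_i w i *: (f i - p).
  rewrite -[LHS](subrK p) addrC (gP _ yp); congr (_ + _); apply: eq_bigr => i _.
  rewrite -/(a i) /w /f; case: ifPn => iJ; last by rewrite scale0r scaler0.
  case: ifPn => // _; have [/andP[e0 _] _] := eP i iJ.
  by rewrite addrAC subrr add0r scalerN scalerA divfK ?gt_eqF// scaleNr opprK.
congr hull; rewrite scalerBl scale1r scaler_suml -addrA; congr (_ + _).
by rewrite addrC -sumrB; apply: eq_bigr => i _; rewrite scalerBr.
Qed.

End Faces.

(** * Carrier faces, nearby faces and vertices of a polytope *)

Section Polytope.
Context {R : realType} {m : nat} (P : set 'rV[R]_m) (polyP : polytope P).
Implicit Types (F : set 'rV[R]_m) (p q v : 'rV[R]_m).

Lemma polytope_hull : exists N (A : 'M[R]_(N, m)), P = hull A [set: 'I_N]%SET.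
Proof.
case: polyP => S /finite_seqP[s ->] ->.
pose A := \matrix_(i < size s) nth 0 s i; exists (size s), A.
have As i : row i A \in s by rewrite rowK mem_nth.
apply/seteqP; split.
  apply: smallest_sub => [|x /= xs]; first exact: convex_hull_rows.
  have xi : (index x s < size s)%N by rewrite index_mem.
  by have := hull_row A (finset.in_setT (Ordinal xi)); rewrite rowK/= nth_index.
apply: hull_min => [|i _].
  move=> x y t /set_mem xP /set_mem yP; apply: mem_set => C [convC sC].
  by apply/set_mem/convC; apply: mem_set; [exact: xP | exact: yP].
by move=> C [_]; apply; exact: As.
Qed.

Lemma polytope_convex p q (t : R) : P p -> P q -> 0 <= t <= 1 -> P ((1 - t) *: p + t *: q).
Proof.
have [N [A ->]] := polytope_hull => Pp Pq t01.
by apply: convex_set_seg => //; exact: convex_hull_rows.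
Qed.

Lemma carrier_faceP p : P p ->
  face P (carrier_face P p) /\ relative_interior (carrier_face P p) p.
Proof.
move=> Pp; rewrite /carrier_face.
suff /xgetPex : exists F, [set F | face P F /\ relative_interior F p] F by apply.
move: Pp; have [N [A ->]] := polytope_hull => /minimal_face[c [b [cb tp min]]].
exists (hull A (tight A c b)); split; last exact: minimal_face_interior.
by apply/face_hullP; exists c, b.
Qed.

Lemma face_sub F : face P F -> F `<=` P.
Proof. by move=> [c [b [_ ->]]] x []. Qed.

Lemma vertex_mem v : vertices P v -> P v.
Proof. by move=> fv; exact: (face_sub fv). Qed.

(** A segment in [F] from [y] to [q] extends a little beyond [q]. If [y] were strictly below the
    hyperplane supporting [F'], the extension would be strictly above it. *)
Lemma relative_interior_sub_face F F' q : F `<=` P -> relative_interior F q ->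
  face P F' -> F' q -> F `<=` F'.
Proof.
move=> FP [Fq near_q] [c [b [Pcb ->]]] [_ /= qb] y Fy; split; first exact: FP.
apply/eqP; rewrite /= eq_le Pcb/=; last exact: FP.
have aff : forall t : R, affine_hull F (q + t *: (q - y)).
  move=> t C [aC FC]; have := aC _ _ (- t) (FC _ Fq) (FC _ Fy).
  by congr C; rewrite opprK scalerDl scale1r scaleNr scalerBr addrA.
have cvt : (q + t *: (q - y)) @[t --> (0 : R)] --> q.
  rewrite -[X in _ --> X]addr0 -(scale0r (q - y)).
  by apply: cvgD; [exact: cvg_cst | apply: cvgZr_tmp; exact: cvg_id].
have [t [Ft t0]] : exists t : R, F (q + t *: (q - y)) /\ 0 < t.
  apply: (@filter_ex _ (0 : R)^'+).
  apply: filterI; last exact: nbhs_right_gt.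
  have : \forall t \near (0 : R)^'+, affine_hull F (q + t *: (q - y)) ->
      F (q + t *: (q - y)) by exact: (cvg_at_right_filter cvt near_q).
  by apply: filterS => t; apply.
have := Pcb _ (FP _ Ft); rewrite dotDl dotZl dotBl qb gerDl pmulr_rle0//.
by rewrite subr_le0.
Qed.

(** This turns the inclusion of faces in [face_group] into membership of the point [p]. *)
Lemma carrier_face_sub p F : P p -> face P F -> (carrier_face P p `<=` F <-> F p).
Proof.
move=> Pp Ff; have [fC rC] := carrier_faceP Pp.
split=> [|Fp]; first by apply; case: rC.
exact: relative_interior_sub_face (face_sub fC) rC Ff Fp.
Qed.

(** There are finitely many faces, one at most for each set of rows, and each is closed; those that
    miss [p] miss a neighborhood of it. *)
Lemma near_face p : P p -> \forall q \near p, forall F, face P F -> F q -> F p.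
Proof.
have [N [A ->]] := polytope_hull => Pp.
suff : \forall q \near p, forall J : {set 'I_N},
    face (hull A [set: 'I_N]%SET) (hull A J) -> hull A J q -> hull A J p.
  by apply: filterS => q H F /[dup] /face_hullP[c [b [_ ->]]]; exact: H.
apply: (@filter_forall _ _ _ (nbhs p) _) => J.
have [[fJ Jp]|H] := pselect (face (hull A [set: 'I_N]%SET) (hull A J) /\ ~ hull A J p).
  case: fJ Jp => c [b [cb ->]] pJ.
  have pb : p *d c < b.
    rewrite lt_neqAle cb// andbT; apply/negP => /eqP pb; exact: pJ.
  have : \forall q \near p, q *d c < b.
    exact: (cvgr_lt _ (@dot_continuous R m c p) _ pb).
  by apply: filterS => q qb _ [_ /= qb']; move: qb; rewrite qb' ltxx.
by apply: filterE => q fJ _; apply: contrapT => pJ; exact: H.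
Qed.

(** Any vertex in the carrier face of [p] will do. Hence the stars of the vertices cover the
    polytope. *)
Lemma vertex_in_carrier p : P p -> exists2 v, vertices P v &
  forall F, face P F -> F p -> F v.
Proof.
move=> Pp; have [fC [Cp _]] := carrier_faceP Pp.
suff [v vP vC] : exists2 v, vertices P v & carrier_face P p v.
  by exists v => // F fF Fp; have [_ +] := carrier_face_sub Pp fF; move=> /(_ Fp); exact.
move: fC Cp; move: (carrier_face P p) => F; have [N [A ->]] := polytope_hull.
by move=> /face_hullP[c [b [cb ->]]] tp; apply: vertex_in_face => //; exists p.
Qed.

Lemma facet_avoiding n v p : has_dim P n -> vertices P v -> P p -> p <> v ->
  exists F, [/\ facets P F, F v & ~ F p].
Proof.
have [N [A ->]] := polytope_hull => dimP /face_hullP[c [b [cb vE]]] Pp pv.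
have tv : hull A (tight A c b) v by rewrite -vE.
apply: (exists_facet dimP cb tv Pp); rewrite lt_neqAle (hull_le cb Pp) andbT.
by apply/negP => /eqP pb; apply: pv; rewrite -[p = v]/([set v] p) vE -hull_tight.
Qed.

End Polytope.

(** * Groups attached to points *)

Lemma card_eq_enum (T : pointedType) (A : set T) (n : nat) : (A #= `I_n)%card ->
  exists e : 'I_n -> T, [/\ injective e, forall i, A (e i) &
    forall x, A x -> exists i, e i = x].
Proof.
rewrite card_eq_sym => /card_set_bijP[f [fA finj fsurj]].
exists (fun i => f i); split.
- move=> i j fij; apply/val_inj; apply: finj => //; apply/mem_set; exact: ltn_ord.
- by move=> i; apply: fA; exact: ltn_ord.
- by move=> x /fsurj[i /= ik <-]; exists (Ordinal ik).
Qed.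

(** * Linear spans and generated subgroups over the field with two elements *)

Section Z2Span.
Context {n : nat}.
Implicit Types (s : seq 'rV['F_2]_n) (V : {vspace 'rV['F_2]_n}).

Lemma span_sub_group s (H : {group 'rV['F_2]_n}) (g : 'rV['F_2]_n) :
  (forall x, x \in s -> x \in H) -> g \in << s >>%VS -> g \in H.
Proof.
elim: s g => [|x s IH] g sH.
  by rewrite span_nil memv0 => /eqP ->; exact: group1.
rewrite span_cons => /memv_addP[_ /vlineP[t ->]] [z zs ->].
apply: (@groupM _ H); last by apply: IH zs => y ys; apply: sH; rewrite inE ys orbT.
(* Scalars act as natural multiples, which are powers in the additive group. *)
have -> : t *: x = x *+ t by rewrite -scaler_nat natr_Zp.
by rewrite -FinRing.zmodXgE groupX// sH ?mem_head.
Qed.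

Lemma gen_sub_vspace (S : {set 'rV['F_2]_n}) V (g : 'rV['F_2]_n) :
  (forall x, x \in S -> x \in V) -> g \in <<S>>%g -> g \in V.
Proof.
move=> SV.
have gV : group_set (finset (fun x => x \in V)).
  apply/group_setP; split=> [|x y]; first by rewrite inE; exact: mem0v.
  by rewrite !inE; exact: memvD.
have : (<<S>> \subset Group gV)%g.
  by rewrite gen_subG; apply/fintype.subsetP => x /SV xV; rewrite inE.
by move=> /fintype.subsetP sub /sub; rewrite inE.
Qed.

End Z2Span.

Lemma dim_row (n : nat) : \dim (fullv : {vspace 'rV['F_2]_n}) = n.
Proof. by rewrite dimvf dim_matrix; exact: mul1n. Qed.

Section FaceGroups.
Context {R : realType} {m n : nat} (P : set 'rV[R]_m) (lambda : facets P -> 'rV['F_2]_n).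
Context (polyP : polytope P).
Implicit Types (p q v : 'rV[R]_m) (F : set 'rV[R]_m).

Definition point_group p := face_group lambda (carrier_face P p).

Lemma facet_face (F : facets P) : face P (val F).
Proof. by have [] := set_mem (valP F). Qed.

(** By [carrier_face_sub] the generators at a point are the vectors of the facets through it, so
    more facets give a larger group. *)
Lemma point_group_sub p q : P p -> P q ->
  (forall F, facets P F -> F p -> F q) -> point_group p \subset point_group q.
Proof.
move=> Pp Pq pq; apply: genS; apply/fintype.subsetP => g.
rewrite !inE => -[F pF <-]; exists F => //.
have fF := facet_face F.
apply: (carrier_face_sub polyP Pq fF).2; apply: pq; first exact: set_mem (valP F).
exact: (carrier_face_sub polyP Pp fF).1 pF.
Qed.

Context (simpleP : simple_polytope n P) (charP : characteristic_function lambda).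

Lemma vertex_facets v : vertices P v -> exists e : 'I_n -> facets P,
  [/\ injective e, forall i, val (e i) v &
    forall F : facets P, val F v -> exists i, e i = F].
Proof.
case: simpleP => _ _ /[apply] /card_eq_enum[e [inj_e ev e_surj]].
have fe i : e i \in facets P by apply/mem_set; case: (ev i).
exists (fun i => SigSub (fe i) : facets P); split.
- by move=> i j /(congr1 val)/= /inj_e.
- by move=> i; case: (ev i).
- move=> F Fv; have [|i eF] := e_surj (val F); last by exists i; apply: val_inj.
  by split=> //; exact: set_mem (valP F).
Qed.

Lemma vertex_span v (e : 'I_n -> facets P) : injective e ->
  (forall i, val (e i) v) -> << [seq lambda (e i) | i <- enum 'I_n]>>%VS = fullv.
Proof.
move=> inj_e ev; apply/eqP; rewrite eqEdim subvf/= dim_row.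
by rewrite charP//; exists v => i _; exact: ev.
Qed.

Lemma vertex_group v g : vertices P v -> g \in point_group v.
Proof.
move=> vv; have Pv := vertex_mem vv; have [e [inj_e ev _]] := vertex_facets vv.
have : g \in << [seq lambda (e i) | i <- enum 'I_n]>>%VS.
  by rewrite (vertex_span inj_e ev) memvf.
rewrite /point_group /face_group; apply: span_sub_group => _ /mapP[i _ ->].
apply: mem_gen; rewrite !inE; exists (e i) => //.
exact: (carrier_face_sub polyP Pv (facet_face _)).2 (ev i).
Qed.

(* Near v a point q lies on at most the n facets at v, and it avoids one of them
   unless q = v; fewer than n vectors do not span. *)
Lemma near_vertex_group v : vertices P v -> \forall q \near v,
  P q -> (forall g, g \in point_group q) -> q = v.
Proof.
move=> vv; have Pv := vertex_mem vv; have [e [inj_e ev e_surj]] := vertex_facets vv.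
have dimP : has_dim P n by case: simpleP.
apply: filterS (near_face polyP Pv) => q qv Pq Gq; apply: contrapT => qNv.
have [F [fF Fv NFq]] := facet_avoiding polyP dimP vv Pq qNv.
pose D := finset (fun i : 'I_n => `[< val (e i) q >]).
have DT : (#|D| < n)%N.
  have [j ej] := e_surj (SigSub (mem_set fF)) Fv.
  rewrite -[ltnRHS]card_ord -cardsT; apply: proper_card; rewrite finset.properT.
  by apply/eqP => DT; have := finset.in_setT j; rewrite -DT !inE ej => /NFq.
suff : (n <= #|D|)%N by rewrite leqNgt DT.
have spanD : << [seq lambda (e i) | i <- enum D]>>%VS = fullv.
  apply/vspaceP => g; rewrite memvf.
  apply: gen_sub_vspace (Gq g) => _ /[!inE] -[F' qF' <-].
  have fF' := facet_face F'.
  have F'q := (carrier_face_sub polyP Pq fF').1 qF'.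
  have [i ei] := e_surj F' (qv _ fF' F'q).
  rewrite -ei; apply/memv_span/map_f; by rewrite mem_enum !inE ei.
rewrite -[leqLHS]dim_row -spanD.
by apply: leq_trans (dim_span _) _; rewrite size_map -cardE.
Qed.

End FaceGroups.

(** * Open stars in the small cover *)

Section SmallCoverCategory.
Context {R : realType} {m n : nat} {P : set 'rV[R]_m}
  {lambda : facets P -> 'rV['F_2]_n}.
Context (polyP : polytope P).

Local Notation X := (@cover_space R m n P).
Local Notation M := (small_cover lambda).
Local Notation pi := (small_cover_pi lambda).
Local Notation act := (@small_cover_act R m n P lambda).

Definition cover_repr (y : M) : X := generic_quotient.repr (y : {eq_quot (cover_equiv lambda)}).

(** The orbit map of the small cover onto [P], followed by the inclusion. *)
Definition cover_proj (y : M) : 'rV[R]_m := val (cover_repr y).1.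

Lemma pi_repr (y : M) : pi (cover_repr y) = y.
Proof. exact: reprK. Qed.

Lemma cover_proj_in (y : M) : P (cover_proj y).
Proof. exact/set_mem/valP. Qed.

Lemma pi_eqP (x y : X) : pi x = pi y <->
  x.1 = y.1 /\ - (x.2 : 'rV['F_2]_n) + y.2 \in point_group lambda (val x.1).
Proof.
split=> [/eqmodP/asboolP //|xy]; apply/eqmodP; exact/asboolP.
Qed.

Lemma repr_pi (x : X) : (cover_repr (pi x)).1 = x.1 /\
  - (x.2 : 'rV['F_2]_n) + (cover_repr (pi x)).2 \in point_group lambda (val x.1).
Proof. by have /pi_eqP[] := esym (pi_repr (pi x)). Qed.

Lemma cover_proj_pi (x : X) : cover_proj (pi x) = val x.1.
Proof. by rewrite /cover_proj (repr_pi x).1. Qed.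

Lemma cover_proj_act g y : cover_proj (act g y) = cover_proj y.
Proof.
by rewrite -[y]pi_repr; case: (cover_repr y) => p h; rewrite small_cover_actE !cover_proj_pi.
Qed.

Lemma val_fst_continuous : continuous (fun x : X => val x.1 : 'rV[R]_m).
Proof.
move=> x; apply: (continuous_comp (f := fst) (g := set_val)); first exact: cvg_fst.
exact: initial_continuous.
Qed.

Lemma cover_proj_continuous : continuous cover_proj.
Proof.
apply/quotient_continuous; rewrite (_ : _ \o _ = fun x : X => val x.1).
  exact: val_fst_continuous.
by apply/funext => x; exact: cover_proj_pi.
Qed.

Lemma fixed_point_group y : (forall g, act g y = y) ->
  forall g, g \in point_group lambda (cover_proj y).
Proof.
move=> + g => /(_ (- g)); rewrite -[y]pi_repr; case: (cover_repr y) => p h.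
by rewrite small_cover_actE cover_proj_pi => /pi_eqP[_] /=; rewrite opprD opprK subrK.
Qed.

Section Star.
Context (v : 'rV[R]_m) (Pv : P v).

Definition star : set M := [set y | forall F, facets P F -> F (cover_proj y) -> F v].

(** The fallback of [insubd] is never reached for [v] in [P] and times in the unit interval. On the
    star, [star_homotopy_pi] removes the dependence on the chosen representative. *)
Definition star_homotopy (z : M * R) : M :=
  let x := cover_repr z.1 in
  pi (insubd x.1 ((1 - z.2) *: val x.1 + z.2 *: v), x.2).

Lemma open_star : open star.
Proof.
rewrite openE => y ystar.
have : \forall z \near y, forall F, face P F -> F (cover_proj z) -> F (cover_proj y).
  exact: (@cover_proj_continuous y _ (near_face polyP (cover_proj_in y))).
apply: filterS => z zy F fF Fz; apply: ystar => //; apply: zy => //.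
by case: fF.
Qed.

Lemma segment_facets p (t : R) : P p -> 0 <= t <= 1 ->
  (forall F, facets P F -> F p -> F v) ->
  forall F, facets P F -> F p -> F ((1 - t) *: p + t *: v).
Proof.
move=> Pp t01 pv F fF Fp; have Fv := pv F fF Fp.
case: fF Fp Fv => -[c [b [_ ->]]] _ [_ /= pb] [_ /= vb].
split; first exact: polytope_convex.
by rewrite /= dotDl !dotZl pb vb; ring.
Qed.

Lemma segment_in p (t : R) : P p -> 0 <= t <= 1 -> (1 - t) *: p + t *: v \in P.
Proof. by move=> Pp t01; apply/mem_set; exact: polytope_convex. Qed.

(** Facets through [p] also contain [q], so the group at [p] lies in the group at [q], and two
    representatives over [p] move to equivalent pairs. *)
Lemma star_homotopy_pi (p q : P) h (t : R) : star (pi (p, h)) -> 0 <= t <= 1 ->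
  val q = (1 - t) *: val p + t *: v -> star_homotopy (pi (p, h), t) = pi (q, h).
Proof.
move=> ph t01 qE; have Pp : P (val p) := set_mem (valP p).
have [/= rp rh] := repr_pi (p, h); rewrite /star_homotopy /=; apply/pi_eqP.
rewrite rp /=; have qq : insubd p ((1 - t) *: val p + t *: v) = q.
  by apply: val_inj; rewrite val_insubd segment_in.
split=> //; rewrite qq.
have sub : point_group lambda (val p) \subset point_group lambda (val q).
  apply: point_group_sub => //; first exact: set_mem (valP q).
  by rewrite qE; apply: segment_facets => //; rewrite /star /= cover_proj_pi in ph.
have := fintype.subsetP sub _ (groupVr rh).
by rewrite FinRing.zmodVgE opprD opprK addrC.
Qed.

Lemma star_homotopy_act g y (t : R) : star y -> 0 <= t <= 1 ->
  act g (star_homotopy (y, t)) = star_homotopy (act g y, t).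
Proof.
rewrite -[y]pi_repr; case: (cover_repr y) => p h yv t01.
have Pp : P (val p) := set_mem (valP p).
pose q : P := SigSub (segment_in Pp t01).
rewrite (@star_homotopy_pi p q)// !small_cover_actE (@star_homotopy_pi p q)//.
by move: yv; rewrite /star /= !cover_proj_pi.
Qed.

Lemma star_homotopy0 y : star y -> star_homotopy (y, 0) = y.
Proof.
rewrite -[y]pi_repr; case: (cover_repr y) => p h yv.
rewrite (@star_homotopy_pi p p)//; first by rewrite lexx ler01.
by rewrite subr0 scale1r scale0r addr0.
Qed.

Lemma star_homotopy1 y : star y -> exists g, star_homotopy (y, 1) = act g (pi (SigSub (mem_set Pv), 0)).
Proof.
rewrite -[y]pi_repr; case: (cover_repr y) => p h yv; exists h.
rewrite small_cover_actE addr0 (@star_homotopy_pi p (SigSub (mem_set Pv)))//.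
  by rewrite lexx ler01.
by rewrite subrr scale0r scale1r add0r.
Qed.

End Star.

(* The images of N x (g + G_(F(p))), for small neighborhoods N of p, are
   neighborhoods of pi (p, g): they are saturated since G_(F(q)) only shrinks
   near p. *)
Lemma nbhs_sheet (y : M) (N : set 'rV[R]_m) : nbhs (cover_proj y) N ->
  \forall z \near y, N (cover_proj z) /\
    - ((cover_repr y).2 : 'rV['F_2]_n) + (cover_repr z).2 \in point_group lambda (cover_proj y).
Proof.
move=> nN; have Py := cover_proj_in y.
have : nbhs (cover_proj y) (N `&` [set q | forall F, face P F -> F q -> F (cover_proj y)]).
  exact: filterI nN (near_face polyP Py).
rewrite nbhsE => -[N' [oN' N'y] sN'].
pose g := (cover_repr y).2 : 'rV['F_2]_n.
pose B : set M := [set z | N' (cover_proj z) /\ - g + (cover_repr z).2 \in point_group lambda (cover_proj y)].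
(* Over [N'] a change of representative stays inside the group of a nearby point, which is contained
   in the group at [cover_proj y]. *)
have sheet (x : X) : N' (val x.1) ->
    (- g + (cover_repr (pi x)).2 \in point_group lambda (cover_proj y)) =
    (- g + x.2 \in point_group lambda (cover_proj y)).
  move=> /sN'[_ /= near_x]; have [_ rx] := repr_pi x.
  have -> : - g + (cover_repr (pi x)).2 =
      (- g + x.2) + (- (x.2 : 'rV['F_2]_n) + (cover_repr (pi x)).2).
    by rewrite addrA addrK.
  rewrite -FinRing.zmodMgE groupMr//; apply: (fintype.subsetP _ _ rx).
  apply: point_group_sub => //; first exact: set_mem (valP x.1).
  by move=> F [fF _]; exact: near_x.
have oB : open B.
  rewrite /open /= /quotient_open.
  have -> : (\pi_(quotient_topology {eq_quot cover_equiv lambda}) @^-1` B : set X) =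
      (fun x : X => val x.1) @^-1` N' `&`
      (fun x : X => x.2) @^-1` [set h | - g + h \in point_group lambda (cover_proj y)].
    apply/seteqP; split=> x; rewrite /B /= cover_proj_pi => -[N'x]; rewrite -(sheet x)//.
  apply: openI.
    by apply: open_comp => // x _; exact: val_fst_continuous.
  apply: open_comp => [x _|]; first exact: cvg_snd.
  exact: discrete_open.
have By : B y by split=> //; rewrite addNr; exact: group1.
by apply: filterS (open_nbhs_nbhs (conj oB By)) => z [/sN'[]].
Qed.

(** Representatives need not vary continuously, but by [nbhs_sheet] their group components near [y]
    stay in one finite coset. Each [h] in it gives the same point [pi (q, h)], so finitely many
    neighborhoods of [q] are intersected. *)
Lemma star_homotopy_continuous v : P v ->
  {within (star v `*` `[0, 1]%classic : set (M * R)), continuous (star_homotopy v)}.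
Proof.
move=> Pv; apply/subspace_continuousP => -[y t] [/= yv t01] W nW.
have {}nW : nbhs (star_homotopy v (y, t)) W := nW.
have {}t01 : 0 <= t <= 1 by move: t01; rewrite in_itv.
pose g := (cover_repr y).2 : 'rV['F_2]_n.
pose q : P := SigSub (segment_in Pv (cover_proj_in y) t01).
have cE : star_homotopy v (y, t) = pi (q, g).
  rewrite /star_homotopy /= (_ : insubd _ _ = q)//.
  by apply: val_inj; rewrite val_insubd (segment_in Pv (cover_proj_in y) t01).
have sub : point_group lambda (cover_proj y) \subset point_group lambda (val q).
  apply: (point_group_sub lambda polyP (cover_proj_in y) (set_mem (valP q))).
  exact: (segment_facets Pv (cover_proj_in y) t01 yv).
have near_h h : - g + h \in point_group lambda (cover_proj y) ->
    \forall r \near val q, forall a : P, val a = r -> W (pi (a, h)).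
  move=> gh; have qh : pi (q, g) = pi (q, h).
    by apply/pi_eqP; split=> //; exact: fintype.subsetP sub _ gh.
  have : \forall a \near (q : P), W (pi (a, h)).
    have := @pi_continuous X _ (q, h) W; rewrite -/(pi (q, h)) -qh -cE => /(_ nW) Wq.
    have cq : (fun a : P => (a, h) : X) @ (q : P) --> ((q, h) : X).
      exact: (cvg_pair (@cvg_id _ (nbhs (q : P))) (@cvg_cst _ (h : discrete_topology 'rV['F_2]_n) _ (nbhs (q : P)) _)).
    exact: cq _ Wq.
  case=> _ /= [[B oB <-] /= Bq BW].
  have : nbhs (val q) B by exact: open_nbhs_nbhs.
  by apply: filterS => r Br a ar; apply: BW; move: Br; rewrite -ar.
have : \forall r \near val q, forall h, - g + h \in point_group lambda (cover_proj y) ->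
    forall a : P, val a = r -> W (pi (a, h)).
  apply: (@filter_forall _ _ _ (nbhs (val q)) _) => h.
  have [gh|gh] := boolP (- g + h \in point_group lambda (cover_proj y)); last first.
    by apply: filterE => r gh'; case/negP: gh.
  by apply: filterS (near_h h gh) => r rP _; exact: rP.
have cvt : (fun z : 'rV[R]_m * R => (1 - z.2) *: z.1 + z.2 *: v) @ (cover_proj y, t) --> val q.
  apply: cvgD; last by apply: cvgZr_tmp; exact: cvg_snd.
  apply: cvgZ; last exact: cvg_fst.
  by apply: cvgB; [exact: cvg_cst | exact: cvg_snd].
move=> /cvt[[N T] /= [nN nT] NT].
exists ([set z | N (cover_proj z) /\ - g + (cover_repr z).2 \in point_group lambda (cover_proj y)], T).
  by split=> //=; exact: nbhs_sheet.
move=> [z s] /= [[Nz gz] Ts] [/= zv s01].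
have {}s01 : 0 <= s <= 1 by move: s01; rewrite in_itv.
rewrite /star_homotopy /=; apply: (NT (cover_proj z, s)) => //=.
by rewrite val_insubd segment_in//; exact: cover_proj_in.
Qed.

End SmallCoverCategory.

(** * Vertices in categorical sets, and the value of the category *)

Lemma polytope_nonempty (R : realType) (m n : nat) (P : set 'rV[R]_m) :
  has_dim P n -> P !=set0.
Proof.
move=> [x [V [hV _]]]; apply/set0P/eqP => P0.
have : affine_hull P x by rewrite hV /= subrr mem0v.
(* The empty set is affine, so it is its own affine hull. *)
by move=> /(_ set0); apply; split=> //; rewrite P0.
Qed.

(* The component of x in the fixed-point set stays over its vertex, so the
   homotopy cannot move it to another vertex. *)
Lemma categorical_vertex (R : realType) (m n : nat) (P : set 'rV[R]_m)
  (lambda : facets P -> 'rV['F_2]_n) (U : set (small_cover lambda)) :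
  simple_polytope n P -> characteristic_function lambda ->
  categorical R (@small_cover_act R m n P lambda) U ->
  exists w, forall y, U y -> vertices P (cover_proj y) -> cover_proj y = w.
Proof.
(* The final orbit lies over a single point of [P], which is the witness. *)
move=> simpleP charP [H [cH eqH H0 [y0 H1]]]; exists (cover_proj y0) => y Uy vy.
have polyP : polytope P by case: simpleP.
pose gam (t : R) := H (y, t).
have fix_y g : small_cover_act g y = y.
  move: vy; rewrite -[y]pi_repr; case: (cover_repr y) => p h; rewrite cover_proj_pi => vp.
  by rewrite small_cover_actE; apply/pi_eqP; split=> //; exact: vertex_group.
have fix_gam t g : 0 <= t <= 1 -> small_cover_act g (gam t) = gam t.
  by move=> t01; rewrite /gam eqH// fix_y.
have cgam : {within `[0, 1]%classic, continuous (cover_proj \o gam)}.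
  apply/subspace_continuousP => t t01.
  move: cH => /subspace_continuousP/(_ (y, t) (conj Uy t01)) cH.
  apply: (@cvg_comp _ _ _ gam cover_proj _ (nbhs (gam t))); last exact: cover_proj_continuous.
  move=> W /cH[[A B] /= [nA nB] AB].
  apply: filterS nB => s Bs s01; have Ay : A y by exact: (@nbhs_singleton (small_cover lambda) y A nA).
  exact: (AB (y, s) (conj Ay Bs) (conj Uy s01)).
pose C := (cover_proj \o gam) @` `[0, 1]%classic.
have connC : connected C.
  by apply: connected_continuous_connected cgam; exact: segment_connected.
have Cy : C (cover_proj y).
  by exists 0; [rewrite /= in_itv/= lexx ler01 | rewrite /= /gam H0].
have : nbhs (cover_proj y) [set q | P q ->
    (forall g, g \in point_group lambda q) -> q = cover_proj y].
  exact: near_vertex_group.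
rewrite nbhsE => -[B [oB By] BP].
(* The singleton is open and closed in the connected set [C]: points of the path are fixed, and
   inside [B] only the vertex has the full group. *)
have single : [set cover_proj y] = C.
  apply: connC; first by exists (cover_proj y).
  - exists B => //; apply/seteqP; split=> [_ ->//|_ [[t t01 <-] Bt] /=].
    apply: BP => //; first exact: cover_proj_in.
    by apply: fixed_point_group => g; apply: fix_gam; move: t01; rewrite /= in_itv.
  - exists [set cover_proj y]; last by apply/seteqP; split=> [q ->|q []].
    have acc : accessible_space 'rV[R]_m.
      by apply: hausdorff_accessible; exact: norm_hausdorff.
    by move=> q; exact: accessible_closed_set1.
have : C (cover_proj (gam 1)) by exists 1 => //=; rewrite in_itv/= ler01 lexx.
by rewrite -single /= /gam; have [g ->] := H1 y Uy; rewrite cover_proj_act => ->.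
Qed.

Theorem theorem3p6 (R : realType) (m n k : nat) (P : set 'rV[R]_m)
  (lambda : facets P -> 'rV['F_2]_n)
  (hP : simple_polytope n P)
  (hk : (vertices P #= `I_k)%card)
  (hlambda : characteristic_function lambda) :
  equivariant_cat R (@small_cover_act R m n P lambda) = Some k.
Proof.
have [polyP dimP _] := hP.
have [e [e_inj ev e_surj]] := card_eq_enum hk.
(* Upper bound: the stars of the [k] vertices, with [k] positive because [P] is non-empty. *)
have cover_k : categorical_cover R (@small_cover_act R m n P lambda) k.
  split.
    have [p Pp] := polytope_nonempty dimP.
    have [v vv _] := vertex_in_carrier polyP Pp.
    by have [i _] := e_surj v vv; exact: leq_ltn_trans (ltn_ord i).
  exists (fun i => star (lambda := lambda) (e i)); split.
    move=> i; have Pe := vertex_mem (ev i); split.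
    - exact: open_star.
    - by move=> g y yv F fF; rewrite cover_proj_act; exact: yv.
    - exists (star_homotopy (e i)); split.
      + exact: star_homotopy_continuous.
      + by move=> g y t yv t01; exact: star_homotopy_act.
      + by move=> y; exact: star_homotopy0.
      + by exists (small_cover_pi lambda (SigSub (mem_set Pe), 0)) => y; exact: star_homotopy1.
  apply/seteqP; split=> // y _.
  have [v vv vF] := vertex_in_carrier polyP (cover_proj_in y).
  have [i ei] := e_surj v vv; exists i => // F [fF _]; rewrite ei; exact: vF.
rewrite /equivariant_cat; case: pselect => [ex|[]]; last first.
  by exists k; apply/asboolP.
congr Some; case: ex_minnP => j /asboolP[_ [U [Ucat Ucov]]] jmin.
apply/eqP; rewrite eqn_leq jmin/=; last exact/asboolP.
(* Lower bound: [x i] is the fixed point over the vertex [e i]. Choosing a member of the cover for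
   each [x i] is injective by [categorical_vertex]. *)
pose x i := small_cover_pi lambda (SigSub (mem_set (vertex_mem (ev i))), 0).
have /choice[f fP] : forall i, exists l, U l (x i).
  by move=> i; have : [set: small_cover lambda] (x i) by []; rewrite -Ucov => -[l _]; exists l.
have f_inj : injective f.
  move=> i i' ff; apply: e_inj; have [_ _ cat] := Ucat (f i).
  have [w wP] := categorical_vertex hP hlambda cat.
  have := wP (x i) (fP i); have := wP (x i').
  rewrite ff !cover_proj_pi /= => /(_ (fP i') (ev i')) -> /(_ (ev i)) ->.
  by [].
by have := leq_card f f_inj; rewrite !card_ord.
Qed.
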